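(* Suppose that the complex numbers $c_0,\dots,c_5$ are expressed in terms of complex parameters $a_0,a_1,a_2,b_0,b_1$ by $$c_5=3b_1,\qquad c_4=a_2+3\left(b_0+b_1^2\right),\qquad c_3=\left(2a_2+6b_0+b_1^2\right)b_1,$$ $$c_2=a_1+a_2\left(2b_0+b_1^2\right)+3b_0\left(b_0+b_1^2\right),\qquad c_1=a_1b_1+2a_2b_0b_1+3b_0^2b_1,$$ $$c_0=a_0+a_1b_0+a_2b_0^2+b_0^3 .\qquad ( * )$$ Then the parameters are expressed in terms of the $c_n$ (and $b_0$) by $$b_1=\frac{c_5}{3},\qquad a_2=c_4-\frac{c_5^2}{3}-3b_0,$$ $$a_1=c_2-\frac{\left(3c_4-9b_0-c_5^2\right)\left(18b_0+c_5^2\right)}{27}-\frac{b_0\left(9b_0+c_5^2\right)}{3},$$ $$a_0=c_0-a_1b_0-a_2b_0^2-b_0^3,$$ and the coefficients $c_n$ satisfy the two constraints $$27c_3-18c_4c_5+5c_5^3=0,\qquad c_1=\frac{\left(27c_2-3c_4c_5^2+c_5^4\right)c_5}{81}.$$ Moreover $b_0$ remains a free parameter: if $c_0,\dots,c_5$ satisfy these two constraints, then for every choice of $b_0$ the parameters $b_1,a_2,a_1,a_0$ determined by the formulas $$b_1=\frac{c_5}{3},\qquad a_2=c_4-\frac{c_5^2}{3}-3b_0,$$ $$a_1=c_2-\frac{\left(3c_4-9b_0-c_5^2\right)\left(18b_0+c_5^2\right)}{27}-\frac{b_0\left(9b_0+c_5^2\right)}{3},\qquad a_0=c_0-a_1b_0-a_2b_0^2-b_0^3$$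 satisfy $( * )$.
   Context: All coefficients and parameters are complex numbers. The numbers $c_0,\dots,c_5$ are the coefficients of the monic sextic polynomial $P_6(x)=x^6+\sum_{n=0}^{5}c_nx^n$. *)

(* Defs.v *)
From mathcomp Require Import all_boot all_order all_algebra.
From mathcomp Require Import reals.
From mathcomp Require Import complex.

Set Implicit Arguments.
Unset Strict Implicit.
Unset Printing Implicit Defensive.

Import GRing.Theory.
Local Open Scope ring_scope.
Local Open Scope complex_scope.

(** The field of complex numbers is [R[i]] with [R : realType].

    The system is what one gets by comparing coefficients in
      x^6 + c5 x^5 + ... + c0 = y^3 + a2 y^2 + a1 y + a0,
      y = x^2 + b1 x + b0. *)
Definition sextic_param (R : realType)
    (c0 c1 c2 c3 c4 c5 a0 a1 a2 b0 b1 : R[i]) : Prop :=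
  [/\ c5 = 3 * b1,
      c4 = a2 + 3 * (b0 + b1 ^+ 2) &
      c3 = (2 * a2 + 6 * b0 + b1 ^+ 2) * b1] /\
  [/\ c2 = a1 + a2 * (2 * b0 + b1 ^+ 2) + 3 * b0 * (b0 + b1 ^+ 2),
      c1 = a1 * b1 + 2 * a2 * b0 * b1 + 3 * b0 ^+ 2 * b1 &
      c0 = a0 + a1 * b0 + a2 * b0 ^+ 2 + b0 ^+ 3].

(** Once [b0] and the [ci] are given, these equations determine [b1], [a2],
    [a1] and [a0], in this order. *)
Definition sextic_inversion (R : realType)
    (c0 c2 c4 c5 a0 a1 a2 b0 b1 : R[i]) : Prop :=
  [/\ b1 = c5 / 3,
      a2 = c4 - c5 ^+ 2 / 3 - 3 * b0,
      a1 = c2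
           - (3 * c4 - 9 * b0 - c5 ^+ 2) * (18 * b0 + c5 ^+ 2) / 27
           - b0 * (9 * b0 + c5 ^+ 2) / 3 &
      a0 = c0 - a1 * b0 - a2 * b0 ^+ 2 - b0 ^+ 3].

Definition sextic_constraints (R : realType) (c1 c2 c3 c4 c5 : R[i]) : Prop :=
  27 * c3 - 18 * c4 * c5 + 5 * c5 ^+ 3 = 0 /\
  c1 = (27 * c2 - 3 * c4 * c5 ^+ 2 + c5 ^+ 4) * c5 / 81.

(* Main.v *)
Require Import Defs.
From mathcomp Require Import all_boot all_order all_algebra.
From mathcomp Require Import reals complex.
From mathcomp Require Import ring.

Local Open Scope ring_scope.
Local Open Scope complex_scope.

(** For fixed [b0] the equations for [c5], [c4], [c2], [c0] are triangular in [b1], [a2], [a1],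
    [a0]. Substituting their solution into the equations for [c3] and [c1] makes [b0] cancel; what
    remains is the two constraints. *)

Theorem mainTheorem4 (R : realType) (c0 c1 c2 c3 c4 c5 : R[i]) :
  (forall a0 a1 a2 b0 b1 : R[i],
     sextic_param c0 c1 c2 c3 c4 c5 a0 a1 a2 b0 b1 ->
     sextic_inversion c0 c2 c4 c5 a0 a1 a2 b0 b1 /\
     sextic_constraints c1 c2 c3 c4 c5) /\
  (sextic_constraints c1 c2 c3 c4 c5 ->
   forall b0 b1 a2 a1 a0 : R[i],
     sextic_inversion c0 c2 c4 c5 a0 a1 a2 b0 b1 ->
     sextic_param c0 c1 c2 c3 c4 c5 a0 a1 a2 b0 b1).
Proof.
split=> [a0 a1 a2 b0 b1 [[-> -> ->] [-> -> ->]]|[c3E ->] b0 b1 a2 a1 a0].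
  by split; split; field.
(* Solving the constraint for [c3] turns it into a substitution, so only identities in the free
   quantities [c0], [c2], [c4], [c5], [b0] remain for [field]. *)
have {c3E}-> : c3 = (18 * c4 * c5 - 5 * c5 ^+ 3) / 27.
  have -> : c3 = (27 * c3 - 18 * c4 * c5 + 5 * c5 ^+ 3) / 27
                 + (18 * c4 * c5 - 5 * c5 ^+ 3) / 27 by field.
  by rewrite c3E GRing.mul0r GRing.add0r.
case=> -> -> -> ->.
by split; split; field.
Qed.
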